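(* Let $0<\alpha<1$, $\beta\in(0,1]$, $\gamma\in(1,2]$, $a<b$, $T>0$, let $m\ge2$, $n\ge1$ be integers, let $d_\pm,e_\pm$ be non-negative real functions on $[a,b]\times[0,T]$, and let $f$ on $[a,b]\times[0,T]$ and $\phi$ on $[a,b]$ be real functions. Then the implicit difference method $$u_i^{(k+1)}+\omega_1\Big(d_{+,i}^{(k+1)}\sum_{j=0}^{i}g_j^{(\beta)}u_{i-j}^{(k+1)}+d_{-,i}^{(k+1)}\sum_{j=0}^{m-i}g_j^{(\beta)}u_{i+j}^{(k+1)}\Big)-\omega_2\Big(e_{+,i}^{(k+1)}\sum_{j=0}^{i+1}g_j^{(\gamma)}u_{i-j+1}^{(k+1)}+e_{-,i}^{(k+1)}\sum_{j=0}^{m-i+1}g_j^{(\gamma)}u_{i+j-1}^{(k+1)}\Big)=u_i^{(k)}-\sum_{j=1}^{k}a_j\big(u_i^{(k-j+1)}-u_i^{(k-j)}\big)+\omega_3f_i^{(k+1)}$$ for $1\le i\le m-1$, $0\le k\le n-1$ (the last sum being empty for $k=0$), with $u_i^{(0)}=\phi(x_i)$ for $0\le i\le m$ and $u_0^{(k)}=u_m^{(k)}=0$ for $1\le k\le n$, is uniquely solvable: there is exactly one family of real numbers $(u_i^{(k)})_{0\le i\le m,\,0\le k\le n}$ satisfying all these equations.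
   Context: $h=(b-a)/m$, $\tau=T/n$, $x_i=a+ih$ ($0\le i\le m$), $t_j=j\tau$ ($0\le j\le n$). $d_{\pm,i}^{(j)}=d_\pm(x_i,t_j)$, $e_{\pm,i}^{(j)}=e_\pm(x_i,t_j)$, $f_i^{(j)}=f(x_i,t_j)$. $a_0=1$ and $a_j=(j+1)^{1-\alpha}-j^{1-\alpha}$. For $\theta\in\{\beta,\gamma\}$: $g_0^{(\theta)}=1$, $g_j^{(\theta)}=\frac{(-1)^j}{j!}\theta(\theta-1)\cdots(\theta-j+1)$ for $j\ge1$. $\omega_1=\Gamma(2-\alpha)\tau^\alpha/h^\beta$, $\omega_2=\Gamma(2-\alpha)\tau^\alpha/h^\gamma$, $\omega_3=\Gamma(2-\alpha)\tau^\alpha$. *)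

(* Defs.v *)
From mathcomp Require Import all_boot all_order all_algebra.
From mathcomp Require Import all_classical all_reals all_analysis.

Set Implicit Arguments.
Unset Strict Implicit.
Unset Printing Implicit Defensive.

Import Order.TTheory GRing.Theory Num.Theory.
Import numFieldNormedType.Exports.

Local Open Scope classical_set_scope.
Local Open Scope ring_scope.

(* Euler's integral; it agrees with the Gamma function for z > 0. *)
Definition Gamma {R : realType} (z : R) : R :=
  \int[lebesgue_measure]_(t in `]0, +oo[) (t `^ (z - 1) * expR (- t)).

Definition l1coef {R : realType} (alpha : R) (j : nat) : R :=
  if j is 0%N then 1 else j.+1%:R `^ (1 - alpha) - j%:R `^ (1 - alpha).

(* The empty product at j = 0 gives grunwald theta 0 = 1. *)
Definition grunwald {R : realType} (theta : R) (j : nat) : R :=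
  (-1) ^+ j / j`!%:R * \prod_(l < j) (theta - l%:R).

Definition xnode {R : realType} (a b : R) (m i : nat) : R :=
  a + i%:R * ((b - a) / m%:R).

Definition tnode {R : realType} (T : R) (n j : nat) : R :=
  j%:R * (T / n%:R).

Definition omega {R : realType} (alpha tau : R) : R :=
  Gamma (2 - alpha) * tau `^ alpha.

Definition omega_sp {R : realType} (alpha theta tau h : R) : R :=
  omega alpha tau / h `^ theta.

(* The value u_i^(k); meaningful for i <= m and k <= n. *)
Definition gridval {R : realType} {m n : nat} (u : 'M[R]_(m.+1, n.+1))
  (i k : nat) : R := u (inord i) (inord k).

(* The indices i - j + 1 and i + j - 1 are written i.+1 - j and (i + j).-1 so
   that truncated subtraction on nat is exact on the summation ranges. *)
Definition implicit_scheme {R : realType} (alpha beta gamma a b T : R)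
  (m n : nat) (dp dm ep em f : R -> R -> R) (i k : nat)
  (u : 'M[R]_(m.+1, n.+1)) : Prop :=
  let h := (b - a) / m%:R in
  let tau := T / n%:R in
  let xi := xnode a b m i in
  let t1 := tnode T n k.+1 in
  let U := gridval u in
  U i k.+1
  + omega_sp alpha beta tau h *
    (dp xi t1 * (\sum_(0 <= j < i.+1) grunwald beta j * U (i - j)%N k.+1)
     + dm xi t1 *
       (\sum_(0 <= j < (m - i).+1) grunwald beta j * U (i + j)%N k.+1))
  - omega_sp alpha gamma tau h *
    (ep xi t1 *
       (\sum_(0 <= j < i.+2) grunwald gamma j * U (i.+1 - j)%N k.+1)
     + em xi t1 *
       (\sum_(0 <= j < (m - i).+2) grunwald gamma j * U (i + j).-1%N k.+1))
  = U i k
    - \sum_(1 <= j < k.+1) l1coef alpha j * (U i (k - j).+1%N - U i (k - j)%N)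
    + omega alpha tau * f xi t1.

Definition scheme_solution {R : realType} (alpha beta gamma a b T : R)
  (m n : nat) (dp dm ep em f : R -> R -> R) (phi : R -> R)
  (u : 'M[R]_(m.+1, n.+1)) : Prop :=
  [/\ forall i k : nat, (1 <= i <= m.-1)%N -> (k < n)%N ->
        implicit_scheme alpha beta gamma a b T dp dm ep em f i k u,
      forall i : nat, (i <= m)%N -> gridval u i 0 = phi (xnode a b m i) &
      forall k : nat, (1 <= k <= n)%N ->
        gridval u 0 k = 0 /\ gridval u m k = 0].

(* Main.v *)
From HB Require Import structures.
Require Import Defs.
From mathcomp Require Import all_boot all_order all_algebra.
From mathcomp Require Import all_classical all_reals all_analysis.
From mathcomp Require Import ring lra zify.

Import Order.TTheory GRing.Theory Num.Theory.
Local Open Scope ring_scope.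

(** The scheme is solved one time level at a time: the unknowns of level
    [k + 1] satisfy a square linear system whose right-hand side depends only
    on the levels up to [k], so it suffices that each of these systems is
    nonsingular.  This follows from a discrete maximum principle
    ([level_op_le0]).  Suppose that [v] vanishes on the boundary and attains a
    positive maximum at the interior node [i].  The Grünwald coefficients of
    order at most 1 are nonpositive except [g_0], which multiplies [v i], and
    their partial sums are nonnegative; hence the two sums of order [beta] are
    nonnegative at [i].  Those of order between 1 and 2 are nonnegative except
    [g_1], which again multiplies [v i], and their partial sums are nonpositive
    from [j = 1] on; hence the two sums of order [gamma] are nonpositive at
    [i].  The operator applied to [v] is therefore at least [v i > 0] at [i].
    So a vector of the kernel takes no positive value, and neither does its
    opposite.

    The signs of the coefficients and of their partial sums are both read off
    from the product [P_N = prod_(1 <= l <= N) (1 - theta / l)]: one has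
    [g_0 + ... + g_N = P_N] and [g_(N+1) = - theta / (N + 1) * P_N]. *)

(** * Signs of the Grünwald coefficients and of their partial sums *)

Lemma grunwald0 (R : realType) (theta : R) : grunwald theta 0 = 1.
Proof. by rewrite /grunwald big_ord0 expr0 fact0 divr1 mulr1. Qed.

Lemma grunwaldS (R : realType) (theta : R) (j : nat) :
  grunwald theta j.+1
  = - (theta / j.+1%:R) * \prod_(l < j) (1 - theta / l.+1%:R).
Proof.
elim: j => [|j IH].
  by rewrite /grunwald big_ord_recl !big_ord0 /= expr1 subr0 !divr1; ring.
have j1 : 1 + j%:R != 0 :> R by rewrite -(natrD _ 1) pnatr_eq0.
have j2 : 2 + j%:R != 0 :> R by rewrite -(natrD _ 2) pnatr_eq0.
have -> : grunwald theta j.+2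
    = - (theta - j.+1%:R) / j.+2%:R * grunwald theta j.+1.
  rewrite /grunwald [in LHS]big_ord_recr /= exprS (factS j.+1) natrM.
  have fj : (j.+1)`!%:R != 0 :> R by rewrite pnatr_eq0 -lt0n fact_gt0.
  by field; rewrite fj.
rewrite IH [in RHS]big_ord_recr /=.
by field; rewrite j1 j2.
Qed.

Lemma sum_grunwald (R : realType) (theta : R) (N : nat) :
  \sum_(0 <= j < N.+1) grunwald theta j
  = \prod_(l < N) (1 - theta / l.+1%:R).
Proof.
elim: N => [|N IH]; first by rewrite big_nat1 big_ord0 grunwald0.
by rewrite big_nat_recr //= IH grunwaldS big_ord_recr /=; ring.
Qed.

(** The next two lemmas evaluate a Grünwald sum at a node where [w] is
    maximal with nonnegative value [W]: that node carries the coefficient [g_0]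
    when [theta <= 1] and the coefficient [g_1] when [1 <= theta <= 2]. *)
Lemma grunwald_sum_ge0 (R : realType) (theta W : R) (w : nat -> R) (N : nat) :
    0 <= theta <= 1 -> 0 <= W -> w 0%N = W ->
    (forall j, (j <= N)%N -> w j <= W) ->
  0 <= \sum_(0 <= j < N.+1) grunwald theta j * w j.
Proof.
move=> /andP[t0 t1] W0 w0 wW.
have P0 k : 0 <= \prod_(l < k) (1 - theta / l.+1%:R).
  apply: prodr_ge0 => l _; rewrite subr_ge0 ler_pdivrMr ?ltr0n// mul1r.
  by rewrite (le_trans t1)// ler1n.
apply: (@le_trans _ _ (\sum_(0 <= j < N.+1) grunwald theta j * W)).
  by rewrite -mulr_suml sum_grunwald mulr_ge0.
apply: ler_sum_nat => -[|j] /andP[_ jN]; first by rewrite w0.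
apply: ler_wnM2l; last exact: wW.
by rewrite grunwaldS mulNr oppr_le0 mulr_ge0// divr_ge0.
Qed.

Lemma grunwald_sum_le0 (R : realType) (theta W : R) (w : nat -> R) (N : nat) :
    1 <= theta <= 2 -> 0 <= W -> w 1%N = W ->
    (forall j, (j <= N.+1)%N -> w j <= W) ->
  \sum_(0 <= j < N.+2) grunwald theta j * w j <= 0.
Proof.
move=> /andP[t1 t2] W0 w1 wW.
have P0 k : \prod_(l < k.+1) (1 - theta / l.+1%:R) <= 0.
  rewrite big_ord_recl /= divr1 mulr_le0_ge0 ?subr_le0//.
  apply: prodr_ge0 => l _; rewrite subr_ge0 ler_pdivrMr ?ltr0n// mul1r.
  by rewrite (le_trans t2)// ler_nat.
apply: (@le_trans _ _ (\sum_(0 <= j < N.+2) grunwald theta j * W)); last first.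
  by rewrite -mulr_suml sum_grunwald mulr_le0_ge0.
apply: ler_sum_nat => -[|[|j]] /andP[_ jN].
- by rewrite grunwald0 !mul1r wW.
- by rewrite w1.
- apply: ler_wpM2l; last exact: wW.
  by rewrite grunwaldS mulr_le0// oppr_le0 divr_ge0// (le_trans _ t1).
Qed.

(** * The linear system of one time level *)

(** The left-hand side of the scheme at the node [i], as an operator on the
    values [v] of a single time level; [p], [q], [r] and [s] stand for the
    values of [d_+], [d_-], [e_+] and [e_-] at the nodes of that level. *)
Definition level_op {R : realType} (beta gamma w1 w2 : R) (m : nat)
  (p q r s : nat -> R) (v : nat -> R) (i : nat) : R :=
  v i
  + w1 * (p i * (\sum_(0 <= j < i.+1) grunwald beta j * v (i - j)%N)
          + q i * (\sum_(0 <= j < (m - i).+1) grunwald beta j * v (i + j)%N))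
  - w2 * (r i * (\sum_(0 <= j < i.+2) grunwald gamma j * v (i.+1 - j)%N)
          + s i *
            (\sum_(0 <= j < (m - i).+2) grunwald gamma j * v (i + j).-1%N)).

Lemma level_op_lin (R : realType) (beta gamma w1 w2 : R) (m : nat)
    (p q r s v w : nat -> R) (c : R) (i : nat) :
  level_op beta gamma w1 w2 m p q r s (fun l => c * v l + w l) i
  = c * level_op beta gamma w1 w2 m p q r s v i
    + level_op beta gamma w1 w2 m p q r s w i.
Proof.
have sumE (g : nat -> R) (h : nat -> nat) (N : nat) :
    \sum_(0 <= j < N) g j * (c * v (h j) + w (h j))
    = c * (\sum_(0 <= j < N) g j * v (h j)) + \sum_(0 <= j < N) g j * w (h j).
  rewrite mulr_sumr -big_split; apply: eq_bigr => j _ /=.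
  by rewrite mulrDr mulrCA.
rewrite /level_op !(sumE _ (fun j => i - j)%N) !(sumE _ (fun j => i + j)%N).
rewrite !(sumE _ (fun j => i.+1 - j)%N) !(sumE _ (fun j => (i + j).-1)%N).
ring.
Qed.

Lemma eq_level_op (R : realType) (beta gamma w1 w2 : R) (m : nat)
    (p q r s v w : nat -> R) (i : nat) :
    (1 <= i <= m.-1)%N -> (forall l, (l <= m)%N -> v l = w l) ->
  level_op beta gamma w1 w2 m p q r s v i
  = level_op beta gamma w1 w2 m p q r s w i.
Proof.
move=> /andP[i1 im] vw.
have sumE (g : nat -> R) (h : nat -> nat) (N : nat) :
    (forall j, (j < N)%N -> (h j <= m)%N) ->
    \sum_(0 <= j < N) g j * v (h j) = \sum_(0 <= j < N) g j * w (h j).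
  by move=> hN; apply: eq_big_nat => j /andP[_ jN]; rewrite vw// hN.
rewrite /level_op vw; last by lia.
rewrite (sumE _ (fun j => i - j)%N); last by move=> j; lia.
rewrite (sumE _ (fun j => i + j)%N); last by move=> j; lia.
rewrite (sumE _ (fun j => i.+1 - j)%N); last by move=> j; lia.
by rewrite (sumE _ (fun j => (i + j).-1)%N) //; move=> j; lia.
Qed.

Section LevelSystem.
Context {R : realType}.
Variables (beta gamma w1 w2 : R) (m : nat) (p q r s : nat -> R).
Hypotheses (hbeta : 0 <= beta <= 1) (hgamma : 1 <= gamma <= 2).
Hypotheses (w1_ge0 : 0 <= w1) (w2_ge0 : 0 <= w2).
Hypothesis coef_ge0 : forall i, (1 <= i <= m.-1)%N ->
  [/\ 0 <= p i, 0 <= q i, 0 <= r i & 0 <= s i].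

Let L := level_op beta gamma w1 w2 m p q r s.

(** Discrete maximum principle. *)
Lemma level_op_le0 (v : nat -> R) :
    v 0%N <= 0 -> v m <= 0 ->
    (forall i, (1 <= i <= m.-1)%N -> L v i <= 0) ->
  forall i, (i <= m)%N -> v i <= 0.
Proof.
move=> v0 vm Lv.
have [i0 maxv] : exists i0 : 'I_m.+1, forall j : 'I_m.+1, v j <= v i0.
  by case: (@arg_maxP _ R _ ord0 xpredT (fun i : 'I_m.+1 => v i)) => // i0 _ H;
    exists i0 => j; apply: H.
have {}maxv j : (j <= m)%N -> v j <= v i0.
  by move=> jm; apply: (maxv (Ordinal (jm : (j < m.+1)%N))).
suff vi0 : v i0 <= 0 by move=> i im; apply: le_trans (maxv i im) vi0.
have im := ltn_ord i0; move: (i0 : nat) im maxv => {i0} i; rewrite ltnS.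
move=> im maxv; rewrite leNgt; apply/negP => vi.
have i_neq0 : i <> 0%N by move=> i0; move: vi; rewrite i0 ltNge v0.
have i_neqm : i <> m by move=> i0; move: vi; rewrite i0 ltNge vm.
have ii : (1 <= i <= m.-1)%N by lia.
have le_m1 j : (i.+1 - j <= m)%N by lia.
have le_m2 j : (j <= (m - i).+1 -> (i + j).-1 <= m)%N by lia.
have le_m3 j : (i - j <= m)%N by lia.
have le_m4 j : (j <= m - i -> i + j <= m)%N by lia.
have vi_ge0 := ltW vi; have [pi qi ri si] := coef_ge0 i ii.
have := Lv i ii; rewrite leNgt => /negP; apply.
(* The terms added to [v i] in [L v i] have a nonnegative total. *)
apply: (lt_le_trans vi); rewrite /L /level_op -addrA lerDl subr_ge0.
apply: (@le_trans _ _ 0).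
  apply: mulr_ge0_le0 => //; rewrite -oppr_ge0 opprD -!mulrN.
  apply: addr_ge0; apply: mulr_ge0 => //; rewrite oppr_ge0;
    apply: (@grunwald_sum_le0 _ _ (v i)) => //.
  - by rewrite subn1.
  - by move=> j _; apply: maxv.
  - by rewrite addn1.
  - by move=> j jm; apply/maxv/le_m2.
apply: mulr_ge0 => //; apply: addr_ge0; apply: mulr_ge0 => //;
  apply: (@grunwald_sum_ge0 _ _ (v i)) => //.
- by rewrite subn0.
- by move=> j _; apply: maxv.
- by rewrite addn0.
- by move=> j jm; apply/maxv/le_m4.
Qed.

Lemma level_op_inj0 (v : nat -> R) :
    v 0%N = 0 -> v m = 0 ->
    (forall i, (1 <= i <= m.-1)%N -> L v i = 0) ->
  forall i, (i <= m)%N -> v i = 0.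
Proof.
move=> v0 vm Lv i im; apply/eqP; rewrite eq_le; apply/andP; split.
  by apply: level_op_le0 im; rewrite ?v0 ?vm// => j /Lv ->.
(* [- v] is written [-2 * v + v] to fit the form of [level_op_lin]. *)
have LN j : L (fun l => -2 * v l + v l) j = - L v j.
  by rewrite /L level_op_lin; ring.
have := @level_op_le0 (fun l => -2 * v l + v l).
rewrite v0 vm mulr0 addr0 => /(_ (lexx _) (lexx _)) => H.
have : -2 * v i + v i <= 0.
  by apply: (H _ i im) => j jm; rewrite LN Lv// oppr0.
have -> : -2 * v i + v i = - v i by ring.
by rewrite oppr_le0.
Qed.

(** In finite dimension the trivial kernel gives a solution.  The system is
    made square by adding the identity rows [v 0] and [v m]. *)
Lemma level_op_solvable (rhs : nat -> R) :
  exists v : nat -> R, [/\ v 0%N = 0, v m = 0 &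
    forall i, (1 <= i <= m.-1)%N -> L v i = rhs i].
Proof.
pose V (x : 'rV[R]_m.+1) (i : nat) : R := x 0 (inord i).
pose F (x : 'rV[R]_m.+1) : 'rV[R]_m.+1 :=
  \row_i if (1 <= i <= m.-1)%N then L (V x) i else V x i.
have Flin : linear F.
  move=> c x y; apply/rowP => i; rewrite !mxE.
  case: ifP => _; last by rewrite /V !mxE.
  rewrite -[RHS]/(c * L (V x) i + L (V y) i) /L -level_op_lin.
  by congr level_op; apply/funext => l; rewrite /V !mxE.
pose Fl : {linear 'rV[R]_m.+1 -> 'rV[R]_m.+1} :=
  HB.pack F (GRing.isLinear.Build _ _ _ _ F Flin).
have FE x i : (i <= m)%N ->
    V (F x) i = if (1 <= i <= m.-1)%N then L (V x) i else V x i.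
  by move=> im; rewrite {1}/V mxE inordK.
have bd0 : (1 <= 0 <= m.-1)%N = false by [].
have bdm : (1 <= m <= m.-1)%N = false by lia.
have Aunit : lin1_mx Fl \in unitmx.
  rewrite -row_free_unit; apply: inj_row_free => x.
  rewrite mul_rV_lin1 => Fx0; apply/rowP => i; rewrite mxE.
  have V0 l : V (F x) l = 0 by rewrite [F x]Fx0 /V mxE.
  rewrite -[i]inord_val; apply: (level_op_inj0 (V x)); last by rewrite -ltnS.
  - by have := FE x 0%N (leq0n _); rewrite V0 bd0.
  - by have := FE x m (leqnn _); rewrite V0 bdm.
  - move=> l lm; have := FE x l; rewrite V0 lm => <- //; lia.
pose y : 'rV[R]_m.+1 := \row_i if (1 <= i <= m.-1)%N then rhs i else 0.
pose x := y *m invmx (lin1_mx Fl).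
have Fx : F x = y by rewrite -[F x](mul_rV_lin1 Fl) mulmxKV.
have Vy l : (l <= m)%N -> V y l = if (1 <= l <= m.-1)%N then rhs l else 0.
  by move=> lm; rewrite /V mxE inordK.
exists (V x); split.
- by have := FE x 0%N (leq0n _); rewrite Fx Vy// bd0.
- by have := FE x m (leqnn _); rewrite Fx Vy// bdm.
- move=> i im; have := FE x i; rewrite Fx Vy ?im; last by lia.
  by move=> <- //; lia.
Qed.

End LevelSystem.

Arguments level_op_inj0 {R beta gamma w1 w2 m p q r s}.
Arguments level_op_solvable {R beta gamma w1 w2 m p q r s}.

(** * Marching in time *)

Lemma Gamma_ge0 (R : realType) (z : R) : 0 <= Gamma z.
Proof.
by apply: Rintegral_ge0 => t _; rewrite mulr_ge0 ?powR_ge0 ?expR_ge0.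
Qed.

Lemma omega_ge0 (R : realType) (alpha tau : R) : 0 <= omega alpha tau.
Proof. by rewrite mulr_ge0 ?Gamma_ge0 ?powR_ge0. Qed.

Lemma omega_sp_ge0 (R : realType) (alpha theta tau h : R) :
  0 <= omega_sp alpha theta tau h.
Proof. by rewrite divr_ge0 ?omega_ge0 ?powR_ge0. Qed.

Lemma xnode_itv (R : realType) (a b : R) (m i : nat) :
  a <= b -> (0 < m)%N -> (i <= m)%N -> a <= xnode a b m i <= b.
Proof.
move=> ab m0 im; rewrite /xnode lerDl -lerBrDl.
have mR : 0 < m%:R :> R by rewrite ltr0n.
rewrite mulr_ge0 ?divr_ge0 ?subr_ge0//=.
by rewrite mulrCA ler_piMr ?subr_ge0// ler_pdivrMr// mul1r ler_nat.
Qed.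

Lemma tnode_itv (R : realType) (T : R) (n k : nat) :
  0 <= T -> (0 < n)%N -> (k <= n)%N -> 0 <= tnode T n k <= T.
Proof.
move=> T0 n0 kn.
by have := @xnode_itv R 0 T n k T0 n0 kn; rewrite /xnode add0r subr0.
Qed.

(** The right-hand side of the scheme; it involves only the time levels up to
    [k] of the grid function [U]. *)
Definition scheme_rhs {R : realType} (alpha a b T : R) (m n : nat)
  (f : R -> R -> R) (U : nat -> nat -> R) (k i : nat) : R :=
  U i k
  - \sum_(1 <= j < k.+1) l1coef alpha j * (U i (k - j).+1%N - U i (k - j)%N)
  + omega alpha (T / n%:R) * f (xnode a b m i) (tnode T n k.+1).

Lemma eq_scheme_rhs (R : realType) (alpha a b T : R) (m n : nat)
    (f : R -> R -> R) (U U' : nat -> nat -> R) (k i : nat) :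
    (forall l, (l <= k)%N -> U i l = U' i l) ->
  scheme_rhs alpha a b T m n f U k i = scheme_rhs alpha a b T m n f U' k i.
Proof.
move=> UU'; rewrite /scheme_rhs UU' //; congr (_ - _ + _).
apply: eq_big_nat => j /andP[j1 jk].
by rewrite !UU' //; lia.
Qed.

Section TimeMarching.
Context {R : realType}.
Variables (alpha beta gamma a b T : R) (m n : nat).
Variables (dp dm ep em f : R -> R -> R) (phi : R -> R).
Hypotheses (hbeta : 0 <= beta <= 1) (hgamma : 1 <= gamma <= 2).
Hypotheses (hab : a <= b) (hT : 0 <= T).
Hypotheses (m_gt0 : (0 < m)%N) (n_gt0 : (0 < n)%N).
Hypothesis hdp : forall x t : R, a <= x <= b -> 0 <= t <= T -> 0 <= dp x t.
Hypothesis hdm : forall x t : R, a <= x <= b -> 0 <= t <= T -> 0 <= dm x t.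
Hypothesis hep : forall x t : R, a <= x <= b -> 0 <= t <= T -> 0 <= ep x t.
Hypothesis hem : forall x t : R, a <= x <= b -> 0 <= t <= T -> 0 <= em x t.

Let h := (b - a) / m%:R.
Let tau := T / n%:R.
Let at_node (c : R -> R -> R) (k i : nat) : R :=
  c (xnode a b m i) (tnode T n k.+1).

Let L (k : nat) : (nat -> R) -> nat -> R :=
  level_op beta gamma (omega_sp alpha beta tau h) (omega_sp alpha gamma tau h)
    m (at_node dp k) (at_node dm k) (at_node ep k) (at_node em k).

Let rhs := scheme_rhs alpha a b T m n f.

Let implicit_schemeE (k i : nat) (u : 'M[R]_(m.+1, n.+1)) :
  implicit_scheme alpha beta gamma a b T dp dm ep em f i k u
  = (L k (gridval u ^~ k.+1) i = rhs (gridval u) k i).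
Proof. by []. Qed.

Let coef_ge0 (k : nat) : (k < n)%N -> forall i, (1 <= i <= m.-1)%N ->
  [/\ 0 <= at_node dp k i, 0 <= at_node dm k i,
      0 <= at_node ep k i & 0 <= at_node em k i].
Proof.
move=> kn i im.
have xi : a <= xnode a b m i <= b by apply: xnode_itv => //; lia.
have tk : 0 <= tnode T n k.+1 <= T by apply: tnode_itv.
by split; [apply: hdp | apply: hdm | apply: hep | apply: hem].
Qed.

(** The scheme restricted to the time levels up to [K]. *)
Let solves_upto (K : nat) (u : 'M[R]_(m.+1, n.+1)) : Prop :=
  [/\ forall i k : nat, (1 <= i <= m.-1)%N -> (k < K)%N ->
        implicit_scheme alpha beta gamma a b T dp dm ep em f i k u,
      forall i : nat, (i <= m)%N -> gridval u i 0 = phi (xnode a b m i) &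
      forall k : nat, (1 <= k <= K)%N ->
        gridval u 0 k = 0 /\ gridval u m k = 0].

Let solves_upto_exists (K : nat) : (K <= n)%N -> exists u, solves_upto K u.
Proof.
elim: K => [|K IH] Kn.
  exists (\matrix_(i, k) phi (xnode a b m i)); split => //.
  - by move=> i im; rewrite /gridval mxE inordK.
  - by move=> k; lia.
have [u [schu iniu bdu]] := IH (ltnW Kn).
have [v [v0 vm Lv]] :=
  level_op_solvable hbeta hgamma
    (omega_sp_ge0 _ alpha beta tau h) (omega_sp_ge0 _ alpha gamma tau h)
    (coef_ge0 _ Kn) (rhs (gridval u) K).
pose u' : 'M[R]_(m.+1, n.+1) :=
  \matrix_(i, k) if k == K.+1 :> nat then v i else u i k.
have u'E i k : (i <= m)%N -> (k <= n)%N ->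
    gridval u' i k = if k == K.+1 then v i else gridval u i k.
  by move=> im kn; rewrite {1}/gridval mxE !inordK.
have u'old i k : (i <= m)%N -> (k <= K)%N -> gridval u' i k = gridval u i k.
  by move=> im kK; rewrite u'E//; [case: eqP => //; lia | lia].
exists u'; split.
- move=> i k im kK; rewrite implicit_schemeE.
  have im' : (i <= m)%N by lia.
  have -> : rhs (gridval u') k i = rhs (gridval u) k i.
    by apply: eq_scheme_rhs => l lk; apply: u'old => //; lia.
  move: kK; rewrite ltnS leq_eqVlt => /orP[/eqP->|kK].
    rewrite -Lv//; apply: eq_level_op => // l lm.
    by rewrite u'E// eqxx.
  have := schu i k im kK; rewrite implicit_schemeE => <-.
  apply: eq_level_op => // l lm.
  by rewrite u'old.
- by move=> i im; rewrite u'old// iniu.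
- move=> k /andP[k1 kK]; rewrite !u'E//; try by lia.
  by case: eqP => // kK1; apply: bdu; lia.
Qed.

Let solves_upto_unique (K : nat) (u u' : 'M[R]_(m.+1, n.+1)) :
  (K <= n)%N -> solves_upto n u -> solves_upto n u' ->
  forall i k, (i <= m)%N -> (k <= K)%N -> gridval u i k = gridval u' i k.
Proof.
move=> Kn [schu iniu bdu] [schu' iniu' bdu'].
elim: K Kn => [|K IH] Kn i k im.
  by rewrite leqn0 => /eqP->; rewrite iniu ?iniu'.
rewrite leq_eqVlt => /orP[/eqP->|]; last by move=> kK; apply: IH => //; lia.
(* The difference of two solutions on the level [K + 1], again in the form of
   [level_op_lin]. *)
pose w l := -1 * gridval u' l K.+1 + gridval u l K.+1.
suff : w i = 0 by rewrite /w mulN1r addrC => /eqP; rewrite subr_eq0 => /eqP.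
have K1n : (1 <= K.+1 <= n)%N by [].
apply: (level_op_inj0 hbeta hgamma
    (omega_sp_ge0 _ alpha beta tau h) (omega_sp_ge0 _ alpha gamma tau h)
    (coef_ge0 _ Kn)) => //.
- by rewrite /w (bdu _ K1n).1 (bdu' _ K1n).1 mulr0 addr0.
- by rewrite /w (bdu _ K1n).2 (bdu' _ K1n).2 mulr0 addr0.
- move=> l lm; rewrite level_op_lin.
  have := schu l K lm Kn; have := schu' l K lm Kn.
  rewrite !implicit_schemeE /L => -> ->.
  have -> : rhs (gridval u') K l = rhs (gridval u) K l.
    by apply: eq_scheme_rhs => k' k'K; rewrite (IH _ l k')//; lia.
  by rewrite mulN1r addNr.
Qed.

Lemma scheme_unique_solvability : exists! u : 'M[R]_(m.+1, n.+1),
  scheme_solution alpha beta gamma a b T dp dm ep em f phi u.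
Proof.
have [u solu] := solves_upto_exists _ (leqnn n).
exists u; split=> // u' solu'; apply/matrixP => i k.
rewrite -[i]inord_val -[k]inord_val.
by apply: (solves_upto_unique _ _ _ (leqnn n) solu solu'); rewrite -ltnS.
Qed.

End TimeMarching.

Theorem corollary3p2 (R : realType) (alpha beta gamma a b T : R) (m n : nat)
  (dp dm ep em f : R -> R -> R) (phi : R -> R)
  (halpha : 0 < alpha < 1) (hbeta : 0 < beta <= 1) (hgamma : 1 < gamma <= 2)
  (hab : a < b) (hT : 0 < T) (hm : (2 <= m)%N) (hn : (1 <= n)%N)
  (hdp : forall x t : R, a <= x <= b -> 0 <= t <= T -> 0 <= dp x t)
  (hdm : forall x t : R, a <= x <= b -> 0 <= t <= T -> 0 <= dm x t)
  (hep : forall x t : R, a <= x <= b -> 0 <= t <= T -> 0 <= ep x t)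
  (hem : forall x t : R, a <= x <= b -> 0 <= t <= T -> 0 <= em x t) :
  exists! u : 'M[R]_(m.+1, n.+1),
    scheme_solution alpha beta gamma a b T dp dm ep em f phi u.
Proof.
have hbeta' : 0 <= beta <= 1 by lra.
have hgamma' : 1 <= gamma <= 2 by lra.
exact: scheme_unique_solvability hbeta' hgamma' (ltW hab) (ltW hT)
  (ltnW hm) hn hdp hdm hep hem.
Qed.
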